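(* Let $K$ be an algebraically closed field of characteristic $p>0$ and let $f(x)\in K[x]$ be a monic nonscalar polynomial that has at least two distinct roots. Write $\gcd(f)=p^s\gcd_p(f)$ with $p\nmid\gcd_p(f)$, and $f(x)=f_1^{p^s}(x)$ for the unique monic nonscalar polynomial $f_1(x)\in K[x]$. Let $V\ne0$ be a finite dimensional $\mathbb F_p$-subspace of $K$ and let $\mathbb F_{p^e}$ be the multiplier field of $V$. Then the following statements are equivalent: 1. $\widetilde G_f=\mathrm{Sh}_V\ne\{e\}$ and $\overline G_f=\{e\}$. 2. $f_1(x)=g(f_V(x))$ for a (unique) monic polynomial $g(x)\in K[x]$ such that (a) either $|\mathcal R_d(g)|=1$ and $(p,e)=(2,1)$, or otherwise $|\mathcal R_d(g)|\ge2$ and $\gcd(p^e-1,\gcd_p(g_\nu(x)))=1$ for all $\nu\in\mathcal R_d(f_1)\cup\mathcal R_d(f_1')$, where $g_\nu$ is defined by $f_1(x)=f_V^{i(\nu)}(x-\nu)\,g_\nu(f_V(x-\nu))$, and (b) $\mathcal R(f_1)+\mathbb F_p(\lambda-\lambda')\not\subseteq\mathcal R(f_1)$ for all distinct roots $\lambda$ and $\lambda'$ of $f_1$ such that $\lambda-\lambda'\notin V$ (equivalently, $\mathcal R(f)+\mathbb F_p(\lambda-\lambda')\not\subseteq\mathcal R(f)$ for all distinct roots $\lambda$ and $\lambda'$ of $f$ such that $\lambda-\lambda'\notin V$). Suppose that statement 1 holds. Then $f,f_1\in K[x]^{G_f}=K[x]^{G_{f_1}}$.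
   Context: $\mathrm{Aut}_K(K[x])=\{\sigma_{\lambda,\mu}\mid\lambda\in K^\times,\mu\in K\}$, $\sigma_{\lambda,\mu}(x)=\lambda x+\mu$. The eigengroup of $f$ is $G_f=\{\sigma\in\mathrm{Aut}_K(K[x])\mid\sigma(f)\in K^\times f\}$. Let $\mathrm{Sh}(K)=\{\sigma_{1,\mu}\mid\mu\in K\}$ and $\mathrm{Sh}_V=\{\sigma_{1,v}\mid v\in V\}$. When $f$ has at least two distinct roots, $G_f$ is finite and $G_f=\widetilde G_f\rtimes\overline G_f$, where $\widetilde G_f=G_f\cap\mathrm{Sh}(K)$ and $\overline G_f$ is a (cyclic) complement of the form $\langle\sigma_{\lambda_n,(1-\lambda_n)\nu}\rangle$ with $\lambda_n$ a primitive $n$'th root of unity; so $\overline G_f=\{e\}$ means $G_f=\widetilde G_f$. For a finite dimensional $\mathbb F_p$-subspace $V$ of $K$: $f_V(x)=\prod_{v\in V}(x-v)$ and $f_V^i(x-\nu):=(f_V(x-\nu))^i$; the multiplier field of $V\ne0$ is the largest finite field $\mathbb F_{p^e}$ such that $\mathbb F_{p^e}V\subseteq V$. For $\nu\in K$, the polynomial $f_1(x)=g(f_V(x))$ can be written as $f_V^{i(\nu)}(x-\nu)g_\nu(f_V(x-\nu))$ for a unique natural number $i(\nu)\ge0$ and a unique monic polynomial $g_\nu(x)\in K[x]$ with $g_\nu(0)\ne0$. For a monic polynomial $f=\sum a_ix^i$ of degree $\ge1$, $\gcd(f):=\gcd\{i\ge1\mid a_i\ne0\}$, and $\gcd(f)=p^s\gcd_p(f)$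 with $s\ge0$, $p\nmid\gcd_p(f)$. $\mathcal R_d(h)$ is the set of distinct roots of $h$; $\mathcal R(h)$ is the multiset of roots of $h$ counted with multiplicity, and $\mathcal R(h)+W\subseteq\mathcal R(h)$ means that translation by each element of $W$ maps this multiset into itself. $\mathbb F_p(\lambda-\lambda')$ is the set of $\mathbb F_p$-multiples of $\lambda-\lambda'$; $f_1'$ is the derivative of $f_1$; $K[x]^G$ is the algebra of $G$-invariants. *)

(* Defs.v *)
From HB Require Import structures.
From mathcomp Require Import all_boot all_order all_algebra.
From mathcomp Require Import finmap mathcomp_extra boolp classical_sets functions.
From mathcomp Require Import cardinality fsbigop.

Set Implicit Arguments.
Unset Strict Implicit.
Unset Printing Implicit Defensive.

Import GRing.Theory.
Local Open Scope classical_set_scope.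
Local Open Scope ring_scope.

Section Automorphisms.
Variable K : fieldType.
Implicit Types (f h : {poly K}) (s t : {poly K} -> {poly K}).
Implicit Types (G N H : set ({poly K} -> {poly K})).

(* The K-algebra automorphisms of K[x]; AutKE below shows that they are the
   sigma l m with l != 0. *)
Definition AutK : set ({poly K} -> {poly K}) :=
  [set s | bijective s /\
           exists t : {lrmorphism {poly K} -> {poly K}}, s = t :> (_ -> _)].

Definition sigma (l m : K) : {poly K} -> {poly K} :=
  fun h => h \Po (l *: 'X + m%:P).

Definition eigengroup f : set ({poly K} -> {poly K}) :=
  [set s | AutK s /\ exists2 c : K, c != 0 & s f = c *: f].

Definition Sh (V : set K) : set ({poly K} -> {poly K}) := sigma 1 @` V.

Definition Gtilde f : set ({poly K} -> {poly K}) := eigengroup f `&` Sh setT.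

Definition is_subgroup G : Prop :=
  [/\ G `<=` AutK, G idfun, (forall s t, G s -> G t -> G (s \o t)) &
      forall s, G s -> exists t, [/\ G t, s \o t = idfun & t \o s = idfun]].

(* Internal semidirect product G = N ><| H. *)
Definition is_sdprod G N H : Prop :=
  [/\ [/\ is_subgroup G, is_subgroup N & is_subgroup H],
      N `<=` G /\ H `<=` G,
      (forall s t n, G s -> G t -> s \o t = idfun -> N n -> N (s \o n \o t)),
      N `&` H = [set idfun] &
      forall s, G s -> exists n t, [/\ N n, H t & s = n \o t]].

(* H is a possible choice of the complement of Gtilde f.  The natural powers
   exhaust the cyclic group generated by sigma l ((1 - l) * nu), which has
   finite order n because l is a primitive n-th root of unity. *)
Definition is_Gbar f H : Prop :=
  is_sdprod (eigengroup f) (Gtilde f) H /\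
  exists (n : nat) (l nu : K), n.-primitive_root l /\
    H = [set iter k (sigma l ((1 - l) * nu)) | k in [set: nat]].

Definition invariants G : set {poly K} := [set h | forall s, G s -> s h = h].

End Automorphisms.

Section Subspaces.
Variable K : fieldType.
Implicit Types (V : set K) (g h : {poly K}).

(* In characteristic p the F_p-multiples of v are its natural multiples. *)
Definition Fp_line (v : K) : set K := [set v *+ n | n in [set: nat]].

Definition Fp_subspace V : Prop :=
  [/\ V 0, (forall u v, V u -> V v -> V (u + v)) &
      forall v, V v -> Fp_line v `<=` V].

Definition Fp_fin_dim V : Prop :=
  exists b : seq K, [set` b] `<=` V /\
    forall v, V v -> exists c : 'I_(size b) -> nat, v = \sum_(i < size b) b`_i *+ c i.

(* F_{p^e} inside the algebraically closed field K, for e > 0. *)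
Definition GFsub (p e : nat) : set K := [set c | c ^+ (p ^ e) = c].

Definition stabilized_by (F V : set K) : Prop :=
  forall c v, F c -> V v -> V (c * v).

Definition is_multiplier (p : nat) V (e : nat) : Prop :=
  [/\ (0 < e)%N, stabilized_by (GFsub p e) V &
      forall e', (0 < e')%N -> stabilized_by (GFsub p e') V ->
        GFsub p e' `<=` GFsub p e].

(* f_V; the product is meaningful because V is finite in all uses. *)
Definition subspace_poly V : {poly K} := \big[*%R/1]_(v \in V) ('X - v%:P).

Definition shifted_subspace_poly V (nu : K) : {poly K} :=
  subspace_poly V \Po ('X - nu%:P).

Definition expgcd h : nat := \big[gcdn/0%N]_(1 <= i < size h | h`_i != 0) i.

(* The prime-to-p part of expgcd h. *)
Definition expgcd_p (p : nat) h : nat := ((expgcd h)`_(p^'))%N.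

Definition Rd h : set K := [set x | root h x].

Definition nRd h : nat := #|` fset_set (Rd h)|%fset.

(* The multiset of roots of h is its multiplicity function x |-> mup x h.
   Translating it by w gives y |-> mup (y - w) h. *)
Definition roots_stable h (W : set K) : Prop :=
  forall w, W w -> forall y, (mup (y - w) h <= mup y h)%N.

(* h = f_V^i(x - nu) g(f_V(x - nu)), with i = i(nu) and g = g_nu. *)
Definition nu_decomp V h (nu : K) (i : nat) g : Prop :=
  [/\ g \is monic, g.[0] != 0 &
      h = shifted_subspace_poly V nu ^+ i * (g \Po shifted_subspace_poly V nu)].

Definition cond_a (p e : nat) V f1 g : Prop :=
  (nRd g = 1%N /\ (p, e) = (2, 1)%N) \/
  ((2 <= nRd g)%N /\
   forall nu, (Rd f1 `|` Rd f1^`()) nu ->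
     exists ig, unique (fun jh => nu_decomp V f1 nu jh.1 jh.2) ig /\
       gcdn (p ^ e - 1) (expgcd_p p ig.2) = 1%N).

Definition cond_b V h : Prop :=
  forall x y, root h x -> root h y -> x != y -> ~ V (x - y) ->
    ~ roots_stable h (Fp_line (x - y)).

Definition statement1 V (f : {poly K}) : Prop :=
  [/\ Gtilde f = Sh V, Sh V <> [set idfun] & is_Gbar f [set idfun]].

Definition statement2 (p e : nat) V f1 : Prop :=
  exists g, unique (fun h => h \is monic /\ f1 = h \Po subspace_poly V) g /\
    cond_a p e V f1 g /\ cond_b V f1.

End Subspaces.

Section AutK_description.
Variable K : fieldType.

Lemma lrmorph_comp (t : {lrmorphism {poly K} -> {poly K}}) h :
  t h = h \Po t 'X.
Proof.
elim/poly_ind: h => [|h c IH]; first by rewrite comp_poly0 linear0.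
rewrite linearD rmorphM /= IH comp_polyD comp_polyM comp_polyX comp_polyC.
by rewrite -[c%:P]mulr1 mul_polyC linearZ rmorph1.
Qed.

Lemma sigmaK (l m : K) : l != 0 ->
  cancel (sigma l m) (sigma l^-1 (- (l^-1 * m))).
Proof.
move=> l0 h; rewrite /sigma -comp_polyA comp_polyD comp_polyZ comp_polyX.
rewrite comp_polyC scalerDr scalerA divff // scale1r -addrA -mul_polyC.
by rewrite -polyCM -polyCD mulrN mulrA divff // mul1r addNr addr0 comp_polyXr.
Qed.

Lemma AutKE : @AutK K = [set s | exists l m, l != 0 /\ s = sigma l m].
Proof.
apply/seteqP; split=> [s [[u sK uK] [t st]]|s [l [m [l0 ->]]]].
  pose q := t 'X; have := uK 'X; rewrite st lrmorph_comp -/q => hq.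
  have := size_comp_poly (u 'X) q; rewrite hq size_polyX /= => /esym/eqP.
  rewrite muln_eq1 => /andP[_ sq].
  have sq2 : size q = 2%N by case: (size q) sq => // -[|[|]].
  exists q`_1, q`_0; split.
    by rewrite -[1%N]/(2.-1) -sq2 -lead_coefE lead_coef_eq0 -size_poly_eq0 sq2.
  apply/funext => h; rewrite lrmorph_comp -/q /sigma; congr (_ \Po _).
  apply/polyP => i; rewrite coefD coefZ coefX coefC.
  case: i => [|[|i]] /=; rewrite ?mulr0 ?add0r ?mulr1 ?addr0 //.
  by rewrite nth_default // sq2.
split; last by exists (comp_poly (l *: 'X + m%:P)).
exists (sigma l^-1 (- (l^-1 * m))); first exact: sigmaK.
move=> h; have := @sigmaK l^-1 (- (l^-1 * m)) _ h.
by rewrite invrK mulrN opprK mulrA divff // mul1r; apply; rewrite invr_eq0.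
Qed.

Lemma AutK_linear (s : {poly K} -> {poly K}) (c : K) h :
  AutK s -> s (c *: h) = c *: s h.
Proof. by rewrite AutKE => -[l [m [_ ->]]]; rewrite /sigma comp_polyZ. Qed.

Lemma eigengroup_subgroup (f : {poly K}) : is_subgroup (eigengroup f).
Proof.
split=> [s [] //| |s t [As [c c0 sf]] [At [d d0 tf]]|s [As [c c0 sf]]].
- split; last by exists 1; rewrite ?oner_eq0 // scale1r.
  by rewrite AutKE; exists 1, 0; split; [rewrite oner_eq0|
    apply/funext => h; rewrite /sigma scale1r addr0 comp_polyXr].
- split.
    have [As1 [s' es]] := As; have [At1 [t' et]] := At.
    split; first exact: bij_comp.
    by exists (s' \o t'); rewrite es et.
  exists (d * c); first exact: mulf_neq0.
  by rewrite /= tf AutK_linear // sf scalerA.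
- have [l [m [l0 es]]] : exists l m, l != 0 /\ s = sigma l m.
    by move: As; rewrite AutKE.
  pose t := sigma l^-1 (- (l^-1 * m)).
  have At : AutK t.
    by rewrite AutKE; exists l^-1, (- (l^-1 * m)); rewrite invr_eq0.
  have ts : cancel s t by rewrite es; exact: sigmaK.
  have st : cancel t s.
    by have [[u tu ut] _] := At; move=> h; apply: (can_inj tu); rewrite ts.
  exists t; split; [split=> //|exact/funext|exact/funext].
  exists c^-1; first by rewrite invr_eq0.
  by rewrite -[in RHS](ts f) sf AutK_linear // scalerA mulVf // scale1r.
Qed.

Lemma Gbar_trivialP (f : {poly K}) :
  is_Gbar f [set idfun] <-> eigengroup f = Gtilde f.
Proof.
have idE : sigma (1 : K) 0 = idfun.
  by apply/funext => h; rewrite /sigma scale1r addr0 comp_polyXr.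
have Gf := eigengroup_subgroup f.
split=> [[[_ [NG _] _ _ GNH] _]|GN].
  apply/seteqP; split=> // s /GNH[n [t [Nn -> ->]]].
  exact: Nn.
have [_ G1 GM _] := Gf.
split.
  split=> //.
  - split; [exact: Gf|by rewrite -GN; exact: Gf|].
    split=> [s ->||s t -> ->|s ->]; first by case: G1.
    - exact: erefl.
    - exact: erefl.
    by exists idfun.
  - by split=> [s []|s ->].
  - by rewrite -GN => s t n Gs Gt _ Nn; exact: (GM _ _ (GM _ _ Gs Nn) Gt).
  - by rewrite -GN; apply/seteqP; split=> [s []//|s ->].
  - by move=> s Gs; exists s, idfun; rewrite -GN.
exists 1%N, 1, 0; rewrite mulr0 idE; split.
  by apply/andP; split=> //; apply/forallP => i; rewrite ord1 unity_rootE expr1 eqxx.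
apply/seteqP; split=> [s ->|s [k _ <-]]; first by exists 0%N.
by elim: k => //= k /= ->.
Qed.

End AutK_description.

(* Main.v *)
(* Write F = f_V = prod_(v in V) (X - v).  It is additive and V-invariant, and
   the V-invariant polynomials are exactly the g o F.  If lV is contained in V,
   then comparing the linear coefficients (nonzero, since 0 is a simple root of
   F) in F(lX) = l^|V| F gives l^|V| = l, so F(lX) = l F.

   As f = f1^(p^s), injectivity of Frobenius gives G_f = G_f1.  Condition (b)
   says that the translations preserving f1 are exactly those by V: any such
   translation is the difference of two roots of f1.  An element of G_f1 other
   than a translation is x -> l (x - nu) + nu with l <> 1.  It normalises the
   translations, so l lies in the finite field of all c with cV in V, that is,
   l^(p^e) = l.  Writing f1 = P^i g_nu(P) with P = F(x - nu), which is mapped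
   to l P, such a map is in G_f1 iff l^j = 1 for all exponents j of g_nu.  So a
   nontrivial l exists iff gcd(p^e - 1, gcd_p(g_nu)) > 1.  Only the nu that are
   roots of f1 or f1' matter, by evaluating the eigenvalue equation and its
   derivative at nu.  If g has a single root a, then g_nu = 1 for F(nu) = a, so
   every l with l^(p^e - 1) = 1 occurs, and p^e = 2 is forced. *)
Require Import Defs.
From HB Require Import structures.
From mathcomp Require Import all_boot all_order all_algebra.
From mathcomp Require Import finmap mathcomp_extra boolp classical_sets functions.
From mathcomp Require Import cardinality fsbigop.

Set Implicit Arguments.
Unset Strict Implicit.
Unset Printing Implicit Defensive.

Import GRing.Theory.
Local Open Scope classical_set_scope.
Local Open Scope ring_scope.

(** Pigeonhole: an injective self-map of a finite set is onto. It serves to reindex products over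
    the set. *)
Lemma perm_map_inj (T : eqType) (r : seq T) (g : T -> T) :
  uniq r -> injective g -> {in r, forall x, g x \in r} -> perm_eq (map g r) r.
Proof.
move=> ur gi gr; have us : uniq (map g r) by rewrite map_inj_uniq.
apply: uniq_perm => //; have sub : {subset map g r <= r}.
  by move=> _ /mapP[x xr ->]; exact: gr.
by have [] := uniq_min_size us sub; rewrite size_map.
Qed.

(** * Polynomials of finite additive subgroups *)

Section PolyFacts.
Variable K : fieldType.
Implicit Types (h g : {poly K}) (r : seq K).

Lemma coef_comp_scale h (c : K) i : (h \Po (c *: 'X))`_i = c ^+ i * h`_i.
Proof.
rewrite comp_polyE; under eq_bigr do rewrite exprZn scalerA.
rewrite -(poly_def _ (fun i => h`_i * c ^+ i)) coef_poly mulrC.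
by case: ltnP => // ?; rewrite nth_default // mulr0.
Qed.

Lemma comp_poly_inj g : (1 < size g)%N -> injective (comp_poly g).
Proof.
move=> sg h1 h2 /eqP; rewrite -subr_eq0 -comp_polyB comp_poly_eq0 //.
by rewrite subr_eq0 => /eqP.
Qed.

Lemma comp_translateD h (a b : K) :
  h \Po ('X + a%:P) \Po ('X + b%:P) = h \Po ('X + (a + b)%:P).
Proof.
rewrite -comp_polyA comp_polyD comp_polyX comp_polyC.
by rewrite polyCD -addrA [b%:P + _]addrC.
Qed.

Lemma comp_prod_XsubC r g :
  (\prod_(v <- r) ('X - v%:P)) \Po g = \prod_(v <- r) (g - v%:P).
Proof.
rewrite rmorph_prod; apply: eq_bigr => v _ /=.
by rewrite comp_polyB comp_polyX comp_polyC.
Qed.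

Section FiniteAdditive.
Variables (r : seq K).
Hypotheses (ur : uniq r) (r0 : 0 \in r)
  (rD : {in r &, forall u v, u + v \in r}).
Let F : {poly K} := \prod_(v <- r) ('X - v%:P).

(** The substitution only permutes the factors, since u -> u + v permutes [r]. *)
Lemma prod_XsubC_translate v : v \in r -> F \Po ('X + v%:P) = F.
Proof.
move=> vr; have pm : perm_eq [seq u + v | u <- r] r.
  by apply: perm_map_inj => // [|u ur']; [exact: addIr|exact: rD].
rewrite {1}/F -(perm_big _ pm) comp_prod_XsubC big_map; apply: eq_bigr => u _.
by rewrite polyCD opprD addrACA subrr addr0.
Qed.

(** Multiplication by c permutes [r], and each factor then contributes one c. *)
Lemma prod_XsubC_scale_size (c : K) : c != 0 -> {in r, forall v, c * v \in r} ->
  F \Po (c *: 'X) = c ^+ size r *: F.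
Proof.
move=> c0 cr; have pm : perm_eq [seq c * u | u <- r] r.
  by apply: perm_map_inj => //; exact: mulfI.
rewrite {1}/F -(perm_big _ pm) comp_prod_XsubC big_map /F.
elim: (r) => [|u s IH]; first by rewrite !big_nil scale1r.
by rewrite !big_cons IH polyCM mul_polyC -scalerBr -scalerAl -scalerAr scalerA exprS.
Qed.

(** 0 is a simple root: once the factor X is split off, the coefficient is the product of the -v
    with v nonzero. *)
Lemma prod_XsubC_coef1 : F`_1 != 0.
Proof.
rewrite /F (perm_big _ (perm_to_rem r0)) big_cons subr0 coefXM /=.
rewrite -horner_coef0 horner_prod prodf_seq_neq0; apply/allP => v.
rewrite mem_rem_uniq // inE => /andP[v0 _] /=.
by rewrite hornerXsubC sub0r oppr_eq0.
Qed.

Lemma scale_exp_size (c : K) : {in r, forall v, c * v \in r} ->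
  c ^+ size r = c.
Proof.
have [->|c0] := eqVneq c 0; first by move: r0; case: (r) => // *; rewrite exprS mul0r.
move=> cr; have := congr1 (fun h => h`_1) (prod_XsubC_scale_size c0 cr).
by rewrite coef_comp_scale coefZ expr1 => /(mulIf prod_XsubC_coef1).
Qed.

Lemma prod_XsubC_scale (c : K) : c != 0 -> {in r, forall v, c * v \in r} ->
  F \Po (c *: 'X) = c *: F.
Proof. by move=> c0 cr; rewrite prod_XsubC_scale_size // scale_exp_size. Qed.

Lemma prod_XsubC_dvd h : {in r, forall v, root h v} -> F %| h.
Proof.
by move=> hr; apply: uniq_roots_dvdp; [exact/allP|rewrite uniq_rootsE].
Qed.

Lemma horner_prod_XsubC_mem v : v \in r -> F.[v] = 0.
Proof. by move=> vr; apply/eqP; rewrite -[_ == 0]/(root F v) root_prod_XsubC. Qed.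

(* The difference of both sides has degree smaller than that of F and
   vanishes on r. *)
Lemma prod_XsubC_additive (a : K) : F \Po ('X + a%:P) = F + F.[a]%:P.
Proof.
have sF : size F = (size r).+1 by rewrite size_prod_XsubC.
have Fm : F \is monic by exact: monic_prod_XsubC.
have r_gt0 : (0 < size r)%N by case: (r) r0.
have sX : size ('X + a%:P) = 2%N by rewrite size_XaddC.
apply/eqP; rewrite -subr_eq0; set D := _ - _.
have : F %| D.
  apply: prod_XsubC_dvd => v vr.
  rewrite rootE /D hornerD hornerN [in X in - X]hornerD hornerC (horner_prod_XsubC_mem vr).
  rewrite add0r -{2}(prod_XsubC_translate vr) !horner_comp !hornerD !hornerX !hornerC.
  by rewrite [a + v]addrC subrr.
apply: contraTT => D0; rewrite gtNdvdp // sF ltnS.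
have sD : (size D <= size F)%N.
  rewrite (leq_trans (size_polyD _ _)) // geq_max size_polyN size_comp_poly2 // leqnn.
  by rewrite (leq_trans (size_polyD _ _)) // geq_max leqnn sF (leq_trans (size_polyC_leq1 _)).
rewrite -ltnS -sF; rewrite ltn_neqAle sD andbT; apply: contraNneq D0 => E.
rewrite -lead_coef_eq0 lead_coefE E /D coefB coefD coefC sF /=.
have -> : (F \Po ('X + a%:P))`_(size r) = 1.
  have := lead_coef_comp F (q := 'X + a%:P); rewrite sX lead_coefXaddC expr1n.
  by rewrite (monicP Fm) mulr1 lead_coefE size_comp_poly2 // sF; apply.
have := monicP Fm; rewrite lead_coefE sF /= => ->.
by rewrite gtn_eqF // addr0 subrr.
Qed.

(** Invariance gives h(v) = h(0) on [r], so F divides h - h(0). The quotient is again invariant and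
    has smaller degree, so induction applies to it. *)
Lemma translate_invariant_comp h :
  {in r, forall v, h \Po ('X + v%:P) = h} -> exists g, h = g \Po F.
Proof.
have [n] := ubnP (size h); elim: n h => // n IH h sh hr.
have [h1|h1] := leqP (size h) 1; first by exists h; rewrite (size1_polyC h1) comp_polyC.
have Fm : F \is monic by exact: monic_prod_XsubC.
have r_gt0 : (0 < size r)%N by case: (r) r0.
have [q hq] : exists q : {poly K}, h - h.[0]%:P = q * F.
  apply/dvdpP; apply: prod_XsubC_dvd => v vr; rewrite rootE !hornerE.
  by rewrite -[in h.[0]](hr v vr) horner_comp !hornerE subrr.
move: h.[0] hq => c hq; have hE : h = q * F + c%:P by rewrite -hq subrK.
have q0 : q != 0.
  by apply: contraTneq h1 => q0; rewrite hE q0 mul0r add0r -leqNgt size_polyC_leq1.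
have sq : (size q < n)%N.
  have : (size (q * F)%R <= size h)%N.
    rewrite -hq (leq_trans (size_polyD _ _)) // geq_max leqnn size_polyN.
    by rewrite (leq_trans (size_polyC_leq1 _)) // ltnW.
  rewrite size_Mmonic // size_prod_XsubC addnS /= => le.
  apply: leq_trans (leq_trans le _); last by rewrite -ltnS.
  by rewrite -addn1 leq_add2l.
have [|g qg] := IH q sq.
  move=> v vr; apply: (mulIf (monic_neq0 Fm)).
  rewrite -{1}(prod_XsubC_translate vr) -comp_polyM; apply: (addIr c%:P).
  by rewrite -[in RHS]hE -[in RHS](hr v vr) [in RHS]hE comp_polyD comp_polyC.
exists (g * 'X + c%:P).
by rewrite comp_poly_MXaddC -qg.
Qed.

End FiniteAdditive.

(* A finite subring A satisfies c^|A| = c for c in A by the scaling lemma, so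
   its polynomial is X^|A| - X; translation by 1 forces |A| to be a power
   of p. *)
Lemma finite_subring_GF p r : p \in [pchar K] -> uniq r -> 0 \in r -> 1 \in r ->
  {in r &, forall u v, u + v \in r} -> {in r &, forall u v, u * v \in r} ->
  exists2 k, (0 < k)%N & forall c, (c \in r) = (c ^+ (p ^ k) == c).
Proof.
move=> pK ur r0 r1 rD rM; set N := size r.
have p_pr := pcharf_prime pK.
have rE c : c \in r -> c ^+ N = c.
  by move=> cr; apply: scale_exp_size => // v vr; exact: rM.
have N_gt1 : (1 < N)%N.
  apply: (@uniq_leq_size _ [:: 0; 1]); first by rewrite /= inE eq_sym oner_eq0.
  by move=> x; rewrite !inE => /orP[] /eqP->.
have sN : size ('X^N - 'X : {poly K}) = N.+1.
  by rewrite size_polyDl ?size_polyXn // size_polyN size_polyX ltnS.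
have FE : 'X^N - 'X = \prod_(v <- r) ('X - v%:P) :> {poly K}.
  rewrite [LHS](@all_roots_prod_XsubC _ _ r) //.
  - by rewrite lead_coefE sN /= coefB coefXn eqxx coefX gtn_eqF // subr0 scale1r.
  - by apply/allP => c cr; rewrite rootE !hornerE rE // subrr.
  - by rewrite uniq_rootsE.
(* Translation by 1, an element of [r], fixes X^N - X. *)
have X1 : ('X + 1) ^+ N = 'X^N + 1 :> {poly K}.
  have := prod_XsubC_translate ur rD r1; rewrite -FE polyC1.
  rewrite comp_polyB rmorphXn /= comp_polyX => E.
  by rewrite -[LHS](subrK ('X + 1)) E addrA subrK.
have N_gt0 : (0 < N)%N by exact: ltnW.
have [m pm NE] := pfactor_coprime p_pr N_gt0.
set k := logn p N in NE.
have pKX : p \in [pchar {poly K}] by rewrite pchar_poly.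
have pn : ([pchar {poly K}]).-nat (p ^ k)%N.
  by rewrite pnatX; apply/orP; left; rewrite (eq_pnat _ (pcharf_eq pKX)) pnat_id.
(* Since N = m p^k, Frobenius makes both sides agree after composition with X^(p^k), and this
   composition is injective. *)
have Xm : ('X + 1) ^+ m = 'X^m + 1 :> {poly K}.
  have pk0 : (0 < p ^ k)%N by rewrite expn_gt0 prime_gt0.
  apply: (@comp_poly_inj 'X^(p ^ k)); first by rewrite size_polyXn ltnS.
  rewrite rmorphXn /= !rmorphD !rmorph1 /= rmorphXn /= !comp_polyX.
  by rewrite -exprM mulnC -NE -X1 NE mulnC exprM (exprDn_pchar _ _ pn) expr1n.
have mK : m%:R != 0 :> K.
  by rewrite -(dvdn_pcharf pK) -prime_coprime.
(* The derivatives at 0 are m and m * 0^(m-1); for m > 1 this would make m vanish in K. *)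
have m1 : m = 1%N.
  have := congr1 (fun h => h^`().[0]) Xm.
  rewrite -polyC1 derivD !deriv_exp derivD derivX derivC !addr0 !mul1r.
  rewrite !hornerMn !horner_exp !hornerE ?add0r ?expr1n /=.
  case: (m) mK => [|[|m']] //; first by rewrite eqxx.
  by rewrite expr0n /= ?mul0rn => mK /eqP; rewrite (negbTE mK).
rewrite m1 mul1n in NE.
exists k.
  by case: (k) NE => // NE; rewrite NE in N_gt1.
move=> c; rewrite -NE -root_prod_XsubC -FE rootE !hornerE.
by rewrite subr_eq0.
Qed.

End PolyFacts.

(** * Root multiplicities and translations *)

Section Multiplicities.
Variable K : closedFieldType.
Implicit Types (h : {poly K}) (x y w : K).

Lemma mup_comp_translate h w y : h != 0 ->
  mup y (h \Po ('X + w%:P)) = mup (y + w) h.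
Proof.
move=> h0; have sX : size ('X + w%:P) = 2%N by rewrite size_XaddC.
have hw0 : h \Po ('X + w%:P) != 0 by rewrite comp_poly2_eq0.
suff E n : (n <= mup y (h \Po ('X + w%:P)))%N = (n <= mup (y + w) h)%N.
  by apply/eqP; rewrite eqn_leq -E leqnn E leqnn.
have Xw : ('X - (y + w)%:P) \Po ('X + w%:P) = 'X - y%:P.
  by rewrite comp_polyB comp_polyX comp_polyC polyCD opprD addrACA subrr addr0.
rewrite !mup_geq //; apply/idP/idP => [|/(dvdp_comp_poly ('X + w%:P))].
  move/(dvdp_comp_poly ('X - w%:P)); rewrite comp_polyXaddC_K.
  by rewrite -Xw -rmorphXn /= comp_polyXaddC_K.
by rewrite rmorphXn /= Xw.
Qed.

(** Every root of h1 is a root of h2, so a common linear factor cancels. As K is closed, this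
    continues until h1 is constant. *)
Lemma dvdp_mup h1 h2 : h1 != 0 -> h2 != 0 ->
  (forall y, (mup y h1 <= mup y h2)%N) -> h1 %| h2.
Proof.
have [n] := ubnP (size h1); elim: n h1 h2 => // n IH h1 h2 sn h10 h20 le12.
have [s1|s1] := eqVneq (size h1) 1%N.
  by rewrite (eqp_dvdl h2 (_ : h1 %= 1)) ?dvd1p // -size_poly_eq1 s1.
have /closed_rootP[x rx] := s1.
have rx2 : root h2 x.
  by apply: contraTT (le12 x) => /mupNroot ->; rewrite -ltnNge -XsubC_dvd // dvdp_XsubCl.
have [q1 q1E] := factor_theorem h1 x rx; have [q2 q2E] := factor_theorem h2 x rx2.
move: (h10) (h20); rewrite q1E q2E !mulf_eq0 !negb_or => /andP[q10 X0] /andP[q20 _].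
rewrite dvdp_mul2r // IH // => [|y].
  by move: sn; rewrite q1E size_Mmonic ?monicXsubC // size_XsubC addnC.
by have := le12 y; rewrite q1E q2E !mupM // leq_add2r.
Qed.

Lemma comp_translate_natmul h w n : h \Po ('X + w%:P) = h ->
  h \Po ('X + (w *+ n)%:P) = h.
Proof.
move=> hw; elim: n => [|n IH]; first by rewrite mulr0n addr0 comp_polyXr.
by rewrite mulrS -comp_translateD hw.
Qed.

(** Stability makes h(X - w) divide h, and two monic polynomials of equal degree are then equal.
    Conversely, invariance under w passes to its multiples. *)
Lemma roots_stable_line h w : h \is monic ->
  roots_stable h (Fp_line w) <-> h \Po ('X + w%:P) = h.
Proof.
move=> hm; have h0 := monic_neq0 hm; split=> [st|hw].
  have sX : size ('X + (- w)%:P) = 2%N by rewrite size_XaddC.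
  have sh' := size_comp_poly2 h sX.
  have h'm : h \Po ('X + (- w)%:P) \is monic.
    by rewrite monicE lead_coef_comp ?sX // lead_coefXaddC expr1n mulr1.
  have : h \Po ('X + (- w)%:P) %| h.
    apply: dvdp_mup => // [|y]; first exact: monic_neq0.
    by rewrite mup_comp_translate //; apply: st; exists 1%N.
  move=> /dvdp_size_eqp; rewrite sh' eqxx eqp_monic // => /esym/eqP {1}<-.
  by rewrite comp_translateD addNr addr0 comp_polyXr.
move=> _ [n _ <-] y.
rewrite -[in X in (_ <= X)%N](subrK (w *+ n) y).
by rewrite -(mup_comp_translate (w *+ n) _ h0) comp_translate_natmul.
Qed.
End Multiplicities.

(** * Gcd of the exponents of a polynomial *)

Lemma dvdn_biggcd_seq (I : Type) (s : seq I) (P : pred I) (m : I -> nat) d :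
  (d %| \big[gcdn/0%N]_(i <- s | P i) m i)%N = all (fun i => P i ==> (d %| m i)%N) s.
Proof.
elim: s => [|i s IH]; first by rewrite big_nil dvdn0.
by rewrite big_cons /= -IH; case: (P i); rewrite ?dvdn_gcd.
Qed.

(** The exponent 0 lies outside the range of the gcd, but everything divides it, so the criterion
    may run over all i. *)
Lemma dvdn_expgcd (K : fieldType) (h : {poly K}) d :
  reflect (forall i, h`_i != 0 -> (d %| i)%N) (d %| expgcd h)%N.
Proof.
rewrite /expgcd dvdn_biggcd_seq; apply: (iffP allP) => [H i hi|H i _].
  case: i hi => // i hi; have := H i.+1; rewrite hi; apply.
  rewrite mem_index_iota ltnS leq0n /= ltnNge.
  by apply: contraNN hi => /(nth_default 0) ->.
by apply/implyP; exact: H.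
Qed.

Lemma expgcd_gt0 (K : fieldType) (h : {poly K}) : (1 < size h)%N -> (0 < expgcd h)%N.
Proof.
move=> sh; rewrite lt0n; apply/eqP => h0.
have : (0 %| expgcd h)%N by rewrite h0.
move/dvdn_expgcd => /(_ (size h).-1); rewrite -lead_coefE lead_coef_eq0 -size_poly_gt0.
by rewrite ltnW // dvd0n => /(_ isT)/eqP; case: (size h) sh => [|[]].
Qed.

(** * p-th powers *)

Section Frobenius.
Variables (p : nat) (s : nat).

Lemma pchar_nat_exp (R : nzSemiRingType) : p \in [pchar R] -> ([pchar R]).-nat (p ^ s)%N.
Proof.
move=> pR; rewrite pnatX; apply/orP; left.
by rewrite (eq_pnat _ (pcharf_eq pR)) pnat_id // (pcharf_prime pR).
Qed.

(** Additivity of Frobenius gives (x - y)^(p^s) = 0. *)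
Lemma Frobenius_inj (R : idomainType) : p \in [pchar R] ->
  injective (fun x : R => x ^+ (p ^ s)).
Proof.
move=> pR x y /= E; have := exprDn_pchar (x - y) y (pchar_nat_exp pR).
rewrite subrK E -[LHS]add0r => /addIr/esym/eqP.
by rewrite expf_eq0 subr_eq0 => /andP[_ /eqP].
Qed.

Variable K : closedFieldType.
Hypothesis pK : p \in [pchar K].

Lemma closed_exp_root (c : K) n : (0 < n)%N -> exists d, d ^+ n = c.
Proof.
move=> n0; have /closed_rootP[d] : size ('X^n - c%:P) != 1%N by rewrite size_XnsubC // eqSS -lt0n.
by rewrite rootE !hornerE subr_eq0 => /eqP; exists d.
Qed.

Let pk_gt0 : (0 < p ^ s)%N.
Proof. by rewrite expn_gt0 prime_gt0 // (pcharf_prime pK). Qed.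

Let pKX : p \in [pchar {poly K}].
Proof. by rewrite pchar_poly. Qed.

Lemma poly_Frobenius_root (h : {poly K}) :
  (p ^ s %| expgcd h)%N -> exists h1, h = h1 ^+ (p ^ s).
Proof.
move=> /dvdn_expgcd hd.
have /choice[a aE] (i : nat) : exists a : K, a ^+ (p ^ s) = h`_i.
  exact: closed_exp_root.
exists (\sum_(i < size h) a i *: 'X^(i %/ p ^ s)).
rewrite (big_morph (fun x : {poly K} => x ^+ (p ^ s)) (id1 := 0) (op1 := +%R)); last first.
- by rewrite expr0n gtn_eqF.
- by move=> x y; exact: exprDn_pchar (pchar_nat_exp pKX).
rewrite -[LHS]coefK poly_def; apply: eq_bigr => i _.
rewrite exprZn aE -exprM.
have [->|hi] := eqVneq h`_i 0; first by rewrite !scale0r.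
by rewrite divnK // hd.
Qed.

Lemma sigma_exp (l m : K) (h : {poly K}) n : sigma l m (h ^+ n) = sigma l m h ^+ n.
Proof. by rewrite /sigma rmorphXn. Qed.

Lemma eigengroup_exp_pchar (h : {poly K}) : eigengroup (h ^+ (p ^ s)) = eigengroup h.
Proof.
apply/seteqP; split=> [t [At [c c0]]|t [At [c c0]]];
  move: (At); rewrite AutKE => -[l [m [_ tE]]]; rewrite tE => E; split; rewrite -?tE //.
(* The eigenvalue for h is the p^s-th root d of the eigenvalue c for the power. *)
- have [d dc] := closed_exp_root c pk_gt0; exists d.
    by apply: contraNneq c0 => d0; rewrite -dc d0 expr0n gtn_eqF.
  apply: (Frobenius_inj pKX) => /=.
  by rewrite tE -sigma_exp E exprZn dc.
exists (c ^+ (p ^ s)); first by rewrite expf_neq0.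
by rewrite tE sigma_exp E exprZn.
Qed.

End Frobenius.

(** * Affine substitutions in the eigengroup *)

Section Sigma.
Variable K : fieldType.
Implicit Types (h : {poly K}) (V : set K).

Lemma sigma1 (v : K) : sigma 1 v = fun h => h \Po ('X + v%:P).
Proof. by rewrite /sigma scale1r. Qed.

Lemma sigma_inj (l m l' m' : K) : sigma l m = sigma l' m' -> l = l' /\ m = m'.
Proof.
move=> /(congr1 (fun t => t 'X)); rewrite /sigma !comp_polyX => E.
have := congr1 (fun h : {poly K} => h`_1) E; have := congr1 (fun h : {poly K} => h`_0) E.
by rewrite !coefD !coefZ !coefX !coefC /= !mulr0 !add0r !addr0 !mulr1.
Qed.

(** The eigenvalue is automatically nonzero, because an affine substitution with l <> 0 kills no
    nonzero polynomial. *)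
Lemma eigengroup_sigma h (l m : K) : h \is monic ->
  eigengroup h (sigma l m) <-> l != 0 /\ exists c, sigma l m h = c *: h.
Proof.
move=> hm; split=> [[]|[l0 [c hc]]].
  rewrite AutKE => -[l' [m' [l0 /sigma_inj[-> _]]]] [c _ hc].
  by split=> //; exists c.
split; first by rewrite AutKE; exists l, m.
exists c => //; apply: contraTneq l0 => c0; apply/negP => l0.
have : sigma l m h == 0 by rewrite hc c0 scale0r.
have sX : size (l *: 'X + m%:P) = 2%N.
  by rewrite size_polyDl size_scale ?size_polyX // size_polyC; case: eqP.
by rewrite /sigma comp_poly2_eq0 // (negbTE (monic_neq0 hm)).
Qed.

(** A translation preserves the leading coefficient, which forces c = 1. *)
Lemma monic_translate_eigen h (w c : K) : h \is monic ->
  h \Po ('X + w%:P) = c *: h -> h \Po ('X + w%:P) = h.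
Proof.
move=> hm E; have := congr1 lead_coef E.
rewrite lead_coef_comp ?size_XaddC // lead_coefXaddC expr1n mulr1 lead_coefZ.
by rewrite (monicP hm) mulr1 => c1; rewrite E -c1 scale1r.
Qed.

Lemma eigengroup_sigma1 h (w : K) : h \is monic ->
  eigengroup h (sigma 1 w) <-> h \Po ('X + w%:P) = h.
Proof.
move=> hm; rewrite eigengroup_sigma //; split=> [[_ [c]]|E].
  by rewrite sigma1; exact: monic_translate_eigen.
by split; [exact: oner_neq0|exists 1; rewrite sigma1 E scale1r].
Qed.

Lemma Gtilde_Sh h V : h \is monic ->
  Gtilde h = Sh V <-> forall w, V w <-> h \Po ('X + w%:P) = h.
Proof.
move=> hm; split=> [GV w|H].
  rewrite -eigengroup_sigma1 //; split=> [Vw|Ew].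
    have : Sh V (sigma 1 w) by exists w.
    by rewrite -GV => -[].
  have : Gtilde h (sigma 1 w) by split=> //; exists w.
  by rewrite GV => -[w' Vw' /sigma_inj[_ <-]].
apply/seteqP; split=> [t [Et [w _ tE]]|t [w Vw tE]].
  by exists w => //; apply/H/eigengroup_sigma1 => //; rewrite tE.
split; last by exists w.
by rewrite -tE; apply/eigengroup_sigma1/H.
Qed.

Lemma Sh_nontrivial V : V 0 -> V <> [set 0] -> Sh V <> [set idfun].
Proof.
move=> V0 Vn0 E; apply: Vn0; apply/seteqP; split=> [v Vv|v -> //].
have : Sh V (sigma 1 v) by exists v.
rewrite E => /= idE; have : sigma 1 v = sigma 1 0.
  by rewrite idE sigma1 addr0; apply/funext => h; rewrite comp_polyXr.
by case/sigma_inj.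
Qed.

(** The quotient m / (1 - l) is the fixed point of x -> l x + m, so the substitution becomes a
    scaling about it. *)
Lemma sigma_fixpoint (l m : K) : l != 1 -> m = (1 - l) * (m / (1 - l)).
Proof. by move=> l1; rewrite mulrC divfK // subr_eq0 eq_sym. Qed.

End Sigma.

(** * Finiteness of V, distinct roots and roots of unity *)

Lemma Fp_fin_dim_finite (K : fieldType) p (V : set K) : p \in [pchar K] ->
  Fp_fin_dim V -> finite_set V.
Proof.
move=> pK [b [_ bV]].
have p0 : (0 < p)%N by rewrite prime_gt0 // (pcharf_prime pK).
(* Coefficients matter only modulo p, so V lies in the image of a finite type. *)
pose g (c : {ffun 'I_(size b) -> 'I_p}) : K := \sum_(i < size b) b`_i *+ c i.
apply: (@sub_finite_set _ _ (range g)); last exact: finite_image.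
move=> v /bV[c ->]; exists [ffun i => Ordinal (ltn_pmod (c i) p0)] => //.
apply: eq_bigr => i _; rewrite ffunE /= [in RHS](divn_eq (c i) p) mulrnDr.
by rewrite mulnC mulrnA -(mulr_natr _ p) (pcharf0 pK) mulr0 mul0rn add0r.
Qed.

Section DistinctRoots.
Variable K : closedFieldType.
Implicit Types g : {poly K}.

Lemma finite_Rd g : g != 0 -> finite_set (Rd g).
Proof.
move=> g0; have [rs gE] := closed_field_poly_normal g.
apply/finite_seqP; exists rs; apply/seteqP.
by split=> x; rewrite /Rd /= gE rootZ ?lead_coef_eq0 // root_prod_XsubC.
Qed.

Lemma nRd_le1 g a : Rd g `<=` [set a] -> (nRd g <= 1)%N.
Proof.
move=> ga; rewrite /nRd -(cardfs1 a); apply: fsubset_leq_card.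
by rewrite -fset_set1 -fset_set_sub //; exact: sub_finite_set ga _.
Qed.

Lemma nRd_eq1 g : g != 0 -> nRd g = 1%N -> exists a, Rd g = [set a].
Proof.
move=> g0 /eqP/cardfs1P[a ga]; exists a.
by rewrite -(fset_setK (finite_Rd g0)) ga set_fset1.
Qed.

Lemma nRd_gt0 g : (1 < size g)%N -> (0 < nRd g)%N.
Proof.
move=> sg; have g0 : g != 0 by rewrite -size_poly_gt0 ltnW.
have /closed_rootP[x gx] : size g != 1%N by rewrite gtn_eqF.
rewrite cardfs_gt0; apply/fset0Pn; exists x.
by rewrite in_fset_set ?inE //; exact: finite_Rd.
Qed.

End DistinctRoots.

(** A root of 1 + X + ... + X^(d-1) is a d-th root of unity, and it is not 1 because the value at 1
    is d. *)
Lemma exists_unity_root (K : closedFieldType) d : (1 < d)%N -> d%:R != 0 :> K ->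
  exists2 l : K, l != 1 & l ^+ d = 1.
Proof.
move=> d1 dK; have /closed_rootP[l] : size (\poly_(i < d) (1 : K)) != 1%N.
  by rewrite size_poly_eq ?oner_neq0 // gtn_eqF.
rewrite rootE horner_poly => /eqP; under eq_bigr do rewrite mul1r.
move=> l0; exists l.
  apply: contraNneq dK => l1; rewrite -l0 l1.
  by under eq_bigr do rewrite expr1n; rewrite sumr_const card_ord.
by apply/eqP; rewrite -subr_eq0 subrX1 l0 mulr0.
Qed.

Lemma dvdn_pred_expn_primeN p e d : prime p -> (0 < e)%N ->
  (d %| p ^ e - 1)%N -> ~~ (p %| d)%N.
Proof.
move=> pp e0 de; apply/negP => /dvdn_trans/(_ de) H.
have pe : (p %| p ^ e)%N by rewrite dvdn_exp.
have : (p %| 1)%N by rewrite -(dvdn_addr _ H) subnK // expn_gt0 prime_gt0.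
by rewrite dvdn1 => /eqP p1; rewrite p1 in pp.
Qed.

Lemma XsubC_sigma (K : fieldType) (l nu : K) :
  ('X - nu%:P) \Po (l *: 'X + ((1 - l) * nu)%:P) = l *: ('X - nu%:P).
Proof.
rewrite comp_polyB comp_polyX comp_polyC mulrBl mul1r polyCB polyCM mul_polyC.
by rewrite addrAC addrA subrK scalerBr.
Qed.

(** * The polynomial of V and the multiplier field *)

Section MultiplierField.
Variables (K : closedFieldType) (p e : nat) (V : set K).
Hypotheses (pK : p \in [pchar K]) (Vsub : Fp_subspace V) (Vfin : Fp_fin_dim V)
  (Ve : is_multiplier p V e).
Implicit Types (h g q : {poly K}).
Let F := subspace_poly V.

(** Enumerating V as a sequence makes the facts on finite additive subgroups available for F. *)
Lemma subspace_polyE : exists r : seq K, [/\ uniq r, forall v, v \in r <-> V v,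
  0 \in r, {in r &, forall u v, u + v \in r} & F = \prod_(v <- r) ('X - v%:P)].
Proof.
have fV := Fp_fin_dim_finite pK Vfin; exists (fset_set V).
have rV v : v \in (fset_set V : seq K) <-> V v.
  by rewrite -[_ \in _]/(v \in fset_set V) in_fset_set // inE.
have [V0 VD _] := Vsub.
split; [exact: fset_uniq|exact: rV|exact/rV| |].
  by move=> u v /rV Vu /rV Vv; apply/rV/VD.
by rewrite /F /subspace_poly fsbig_finite.
Qed.

Lemma subspace_poly_monic : F \is monic.
Proof. by have [r [_ _ _ _ ->]] := subspace_polyE; exact: monic_prod_XsubC. Qed.

Lemma subspace_poly_size : (1 < size F)%N.
Proof.
have [r [_ _ r0 _ ->]] := subspace_polyE.
by rewrite size_prod_XsubC ltnS; case: (r) r0.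
Qed.

Lemma subspace_poly_translate v : V v -> F \Po ('X + v%:P) = F.
Proof.
have [r [ur rV r0 rD ->]] := subspace_polyE.
by move=> /rV; exact: prod_XsubC_translate.
Qed.

Lemma subspace_poly_additive a : F \Po ('X + a%:P) = F + F.[a]%:P.
Proof. by have [r [ur rV r0 rD ->]] := subspace_polyE; exact: prod_XsubC_additive. Qed.

Lemma subspace_poly_horner0 : F.[0] = 0.
Proof. by have [r [ur rV r0 rD ->]] := subspace_polyE; exact: horner_prod_XsubC_mem. Qed.

Lemma subspace_poly_comp h :
  (forall v, V v -> h \Po ('X + v%:P) = h) -> exists g, h = g \Po F.
Proof.
have [r [ur rV r0 rD ->]] := subspace_polyE => hV.
by apply: translate_invariant_comp => // v /rV; exact: hV.
Qed.

Lemma subspace_poly_scale (l : K) : l != 0 -> l ^+ (p ^ e) = l ->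
  F \Po (l *: 'X) = l *: F.
Proof.
have [r [ur rV r0 rD ->]] := subspace_polyE => l0 lE.
apply: prod_XsubC_scale => // v /rV Vv; apply/rV.
by case: Ve => _ VS _; exact: VS.
Qed.

(** The multipliers of V form a finite subring, hence some [GFsub p k], which maximality of e places
    inside [GFsub p e]. *)
Lemma mem_multiplier (l : K) : V <> [set 0] -> (forall v, V v -> V (l * v)) ->
  l ^+ (p ^ e) = l.
Proof.
move=> Vn0 lV; have [r [ur rV r0 rD _]] := subspace_polyE.
have [v0 [Vv0 v0n0]] : exists v0, V v0 /\ v0 != 0.
  apply: contrapT => H; apply: Vn0; apply/seteqP; split=> [v Vv|_ ->]; last exact/rV.
  by apply: contrapT => /eqP v0; apply: H; exists v.
(* A multiplier c equals (c v0) / v0 with c v0 in V, so filtering these quotients finds all of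
   them. *)
pose A := [seq c <- [seq v / v0 | v <- r] | all (fun v => c * v \in r) r].
have AE c : c \in A <-> forall v, V v -> V (c * v).
  rewrite mem_filter; split=> [/andP[/allP H _] v /rV vr|H].
    exact/rV/H.
  apply/andP; split; first by apply/allP => v /rV Vv; exact/rV/H.
  by apply/mapP; exists (c * v0); [exact/rV/H|rewrite mulfK].
have [|||||k k0 Ak] := @finite_subring_GF K p A pK.
- by rewrite filter_uniq // map_inj_uniq // => x y /mulIf; apply; rewrite invr_eq0.
- by apply/AE => v _; rewrite mul0r; exact/rV.
- by apply/AE => v; rewrite mul1r.
- move=> a b /AE Aa /AE Ab; apply/AE => v Vv; rewrite mulrDl.
  by case: Vsub => _ VD _; apply: VD; [exact: Aa|exact: Ab].
- by move=> a b /AE Aa /AE Ab; apply/AE => v Vv; rewrite -mulrA; exact/Aa/Ab.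
case: Ve => _ _ /(_ k k0); apply; last by apply/eqP; rewrite -Ak; exact/AE.
by move=> c v /= /eqP; rewrite -Ak => /AE; apply.
Qed.

Lemma shifted_subspace_polyE nu :
  shifted_subspace_poly V nu = F + F.[- nu]%:P.
Proof. by rewrite /shifted_subspace_poly -polyCN subspace_poly_additive. Qed.

Lemma shifted_subspace_poly_monic nu : shifted_subspace_poly V nu \is monic.
Proof.
rewrite shifted_subspace_polyE monicE lead_coefDl ?(monicP subspace_poly_monic) //.
by rewrite (leq_ltn_trans (size_polyC_leq1 _)) // subspace_poly_size.
Qed.

Lemma shifted_subspace_poly_size nu : (1 < size (shifted_subspace_poly V nu))%N.
Proof. by rewrite size_comp_poly2 ?size_XsubC // subspace_poly_size. Qed.

(** F and P differ by a constant, so h is also a polynomial in P; the highest power of X dividing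
    that polynomial gives i. Uniqueness follows from injectivity of composition with P. *)
Lemma nu_decomp_exists h g nu : h \is monic -> h = g \Po F ->
  exists iq, unique (fun jh => nu_decomp V h nu jh.1 jh.2) iq.
Proof.
move=> hm hg; set P := shifted_subspace_poly V nu.
have sP : (1 < size P)%N by exact: shifted_subspace_poly_size.
have Pm : P \is monic by exact: shifted_subspace_poly_monic.
have PX i q : P ^+ i * (q \Po P) = ('X^i * q) \Po P.
  by rewrite comp_polyM rmorphXn /= comp_polyX.
pose b := F.[- nu]; pose g' := g \Po ('X - b%:P).
have hg' : h = g' \Po P.
  rewrite /g' -comp_polyA comp_polyB comp_polyX comp_polyC /P shifted_subspace_polyE.
  by rewrite addrK.
have g'm : g' \is monic.
  by move: hm; rewrite hg' !monicE lead_coef_comp // (monicP Pm) expr1n mulr1.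
have [i [q]] := multiplicity_XsubC g' 0; rewrite (monic_neq0 g'm) /= => q0 g'E.
have g'X : g' = 'X^i * q by rewrite g'E subr0 mulrC.
exists (i, q); split=> [|[j q'] /= [q'm q'0 hq']].
  split=> /=; first by rewrite -(monicMl _ (monicXn K i)) -g'X.
  - by move: q0; rewrite rootE.
  - by rewrite -/P PX -g'X.
move: hq'; rewrite hg' g'X -/P PX => /(comp_poly_inj sP).
(* After cancelling X^m, a surplus power of X on the right would make u vanish at 0. *)
have aux (m n : nat) (u v : {poly K}) : (m <= n)%N -> u.[0] != 0 ->
    'X^m * u = 'X^n * v -> m = n /\ u = v.
  move=> /subnKC <- u0; rewrite exprD -mulrA => /(mulfI (monic_neq0 (monicXn K m))) uE.
  move: u0; rewrite uE; case: (n - m)%N => [|k]; first by rewrite addn0 expr0 mul1r.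
  by rewrite addnS exprS -mulrA hornerM hornerX mul0r eqxx.
have [ij|/ltnW ij] := leqP i j => E; first by have [ij' qq'] := aux _ _ _ _ ij q0 E; rewrite ij' qq'.
by have [ij' qq'] := aux _ _ _ _ ij q'0 (esym E); rewrite ij' qq'.
Qed.

Lemma shifted_subspace_poly_sigma (l nu : K) : l != 0 -> l ^+ (p ^ e) = l ->
  sigma l ((1 - l) * nu) (shifted_subspace_poly V nu) =
    l *: shifted_subspace_poly V nu.
Proof.
move=> l0 lE; rewrite /sigma /shifted_subspace_poly -comp_polyA XsubC_sigma.
have -> : l *: ('X - nu%:P) = (l *: 'X) \Po ('X - nu%:P).
  by rewrite comp_polyZ comp_polyX.
by rewrite comp_polyA subspace_poly_scale // comp_polyZ.
Qed.

Lemma nu_decomp_sigma h nu i q (l : K) : l != 0 -> l ^+ (p ^ e) = l ->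
  nu_decomp V h nu i q ->
  sigma l ((1 - l) * nu) h = l ^+ i *:
   (shifted_subspace_poly V nu ^+ i *
     ((q \Po (l *: 'X)) \Po shifted_subspace_poly V nu)).
Proof.
move=> l0 lE [_ _ ->]; set P := shifted_subspace_poly V nu.
have PE : P \Po (l *: 'X + ((1 - l) * nu)%:P) = l *: P.
  exact: shifted_subspace_poly_sigma.
rewrite /sigma comp_polyM rmorphXn /= PE exprZn -scalerAl; congr (_ *: (_ * _)).
by rewrite -[LHS]comp_polyA PE -comp_polyA comp_polyZ comp_polyX.
Qed.

(** The scaling sends P to l P, hence h to l^i P^i q(l P). Cancelling P^i and then the composition
    with P leaves a comparison of the coefficients of q. *)
Lemma eigen_nu_decomp h nu i q (l : K) : h \is monic ->
  l != 0 -> l ^+ (p ^ e) = l -> nu_decomp V h nu i q ->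
  eigengroup h (sigma l ((1 - l) * nu)) <-> forall j, q`_j != 0 -> l ^+ j = 1.
Proof.
move=> hm l0 lE hd; rewrite eigengroup_sigma // (nu_decomp_sigma l0 lE hd).
have [qm q0 ->] := hd; set P := shifted_subspace_poly V nu.
split=> [[_ [c]]|lq].
  rewrite !scalerAr.
  move/(mulfI (expf_neq0 i (monic_neq0 (shifted_subspace_poly_monic nu)))).
  rewrite -!comp_polyZ.
  move/(comp_poly_inj (shifted_subspace_poly_size nu)) => E.
  have El j : q`_j != 0 -> l ^+ i * l ^+ j = c.
    move=> qj; apply: (mulIf qj); have := congr1 (fun u : {poly K} => u`_j) E.
    by rewrite /= coef_comp_scale !coefZ mulrCA mulrA.
  (* The exponent 0 occurs in q because q(0) <> 0; it identifies c as l^i. *)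
  have := El 0%N; rewrite -horner_coef0 expr0 mulr1 => /(_ q0) lc j /El.
  by rewrite -lc -[RHS]mulr1 => /(mulfI (expf_neq0 i l0)).
split=> //; exists (l ^+ i); congr (_ *: (_ * _)); congr (_ \Po _).
apply/polyP => j; rewrite coef_comp_scale.
by have [->|/lq ->] := eqVneq q`_j 0; rewrite ?mulr0 ?mul1r.
Qed.

End MultiplierField.

(** Taking the n-th power multiplies every root multiplicity by n. *)
Lemma cond_b_exp (K : closedFieldType) (V : set K) (h : {poly K}) n :
  (0 < n)%N -> h != 0 -> cond_b V (h ^+ n) <-> cond_b V h.
Proof.
move=> n0 h0.
have mupX m y : mup y (h ^+ m) = (m * mup y h)%N.
  elim: m => [|m IH]; first by rewrite expr0 mupNroot // root1.
  by rewrite exprS mupM ?expf_neq0 // IH mulSn.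
have rX x : root (h ^+ n) x = root h x by rewrite !rootE horner_exp expf_eq0 n0.
have st W : roots_stable (h ^+ n) W <-> roots_stable h W.
  by split=> H w Ww y; have := H w Ww y; rewrite !mupX leq_pmul2l.
by split=> H x y hx hy xy nV /st; [apply: H|apply: H]; rewrite ?rX // -rX.
Qed.

(** Statement 1 sees the polynomial only through its eigengroup. *)
Lemma statement1_eigengroup (K : fieldType) (V : set K) (h1 h2 : {poly K}) :
  eigengroup h1 = eigengroup h2 -> statement1 V h1 -> statement1 V h2.
Proof.
move=> E [GV V1 /Gbar_trivialP GE].
have GG : Gtilde h1 = Gtilde h2 by rewrite /Gtilde E.
by split; rewrite -?GG //; apply/Gbar_trivialP; rewrite -E -GG.
Qed.

(** * The equivalence *)

Section Equivalence.
Variables (K : closedFieldType) (p e : nat) (V : set K) (h : {poly K}).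
Hypotheses (pK : p \in [pchar K]) (Vsub : Fp_subspace V) (Vfin : Fp_fin_dim V)
  (Vn0 : V <> [set 0]) (Ve : is_multiplier p V e).
Hypotheses (hm : h \is monic) (sh : (1 < size h)%N).
Let F := subspace_poly V.

Let p_pr : prime p. Proof. exact: pcharf_prime pK. Qed.
Let e_gt0 : (0 < e)%N. Proof. by case: Ve. Qed.
Let pe_gt0 : (0 < p ^ e - 1)%N.
Proof.
by rewrite subn_gt0 -(expn0 p) ltn_exp2l // prime_gt1.
Qed.

Lemma statement1E : statement1 V h <->
  (forall w, V w <-> h \Po ('X + w%:P) = h) /\
  (forall l m, eigengroup h (sigma l m) -> l = 1).
Proof.
split=> [[/(Gtilde_Sh _ hm) GV _ /Gbar_trivialP GE]|[GV l1]].
  by split=> // l m; rewrite GE => -[_ [v _ /sigma_inj[<- _]]].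
split; first exact/Gtilde_Sh.
  by apply: Sh_nontrivial => //; case: Vsub.
apply/Gbar_trivialP/seteqP; split=> [t Et|t []//]; split=> //.
have [At _] := Et; move: At; rewrite AutKE => -[l [m [_ tE]]].
by rewrite tE in Et *; rewrite (l1 _ _ Et); exists m.
Qed.

(** Such an l yields a scaling about nu in the eigengroup, which statement 1 allows only for l =
    1. *)
Lemma statement1_scale nu i q (l : K) : statement1 V h -> l ^+ (p ^ e - 1) = 1 ->
  nu_decomp V h nu i q -> (forall j, q`_j != 0 -> l ^+ j = 1) -> l = 1.
Proof.
move=> /statement1E[_ l1] lE hd /(eigen_nu_decomp pK Vsub Vfin Ve hm _ _ hd) H.
apply: (l1 _ ((1 - l) * nu)); apply: H.
  by apply: contra_eq_neq lE => ->; rewrite expr0n gtn_eqF // eq_sym oner_neq0.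
by rewrite -(subnK (_ : 0 < p ^ e)%N) ?exprD ?lE ?mul1r // expn_gt0 prime_gt0.
Qed.

Lemma unity_root_pred d : (1 < d)%N -> (d %| p ^ e - 1)%N ->
  exists l : K, [/\ l != 1, l ^+ d = 1 & l ^+ (p ^ e - 1) = 1].
Proof.
move=> d1 de; have [|l l1 ld] := @exists_unity_root K d d1.
  by rewrite -(dvdn_pcharf pK) (dvdn_pred_expn_primeN p_pr e_gt0 de).
exists l; split=> //; move: de => /dvdnP[k ->].
by rewrite mulnC exprM ld expr1n.
Qed.

Lemma statement1_cond_b : statement1 V h -> cond_b V h.
Proof.
move=> /statement1E[GV _] x y _ _ _ nV /(roots_stable_line _ hm)/GV.
exact: nV.
Qed.

Lemma statement1_cond_a g : statement1 V h -> h = g \Po F -> g \is monic ->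
  cond_a p e V h g.
Proof.
move=> S1 hg gm.
have sF := subspace_poly_size pK Vsub Vfin.
have sg : (1 < size g)%N.
  rewrite ltnNge; apply/negP => /size1_polyC g1; move: sh.
  by rewrite hg g1 comp_polyC ltnNge size_polyC_leq1.
have [g1|g2] := leqP (nRd g) 1.
  have {}g1 : nRd g = 1%N by apply/eqP; rewrite eqn_leq g1 nRd_gt0.
  left; split=> //; have [a gaE] := nRd_eq1 (monic_neq0 gm) g1.
  have ga z : root g z -> z = a.
    by move=> gz; have : Rd g z by []; rewrite gaE.
  (* The centre nu is chosen with F(nu) = a, the only root of g. *)
  have /closed_rootP[nu] : size (F - a%:P) != 1%N.
    rewrite size_polyDl ?gtn_eqF // size_polyN.
    exact: leq_ltn_trans (size_polyC_leq1 _) _.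
  rewrite rootE !hornerE subr_eq0 => /eqP Fnu.
  have [[i q] [/= hd _]] := nu_decomp_exists pK Vsub Vfin nu hm hg.
  have [qm q0 hq] := hd.
  (* A root y of q, written y = P(x), makes x a root of h. Then F(x) = a = F(nu), so y = F(x - nu) =
     0, against q(0) <> 0. *)
  have sq : size q = 1%N.
    apply/eqP/negP => /negP/closed_rootP[y qy].
    have /closed_rootP[x] : size (shifted_subspace_poly V nu - y%:P) != 1%N.
      have sP := shifted_subspace_poly_size pK Vsub Vfin nu.
      rewrite size_polyDl ?gtn_eqF // size_polyN.
      exact: leq_ltn_trans (size_polyC_leq1 _) _.
    rewrite rootE !hornerE subr_eq0 => /eqP Px.
    have : root h x.
      by rewrite hq rootE hornerM horner_comp Px (eqP qy) mulr0.
    rewrite hg root_comp => /ga Fx; move: q0 qy; rewrite rootE.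
    suff -> : y = 0 by move/negP.
    rewrite -Px (shifted_subspace_polyE pK Vsub Vfin) hornerD hornerC Fx -Fnu.
    rewrite -[in RHS](subspace_poly_horner0 pK Vsub Vfin) -(subrr nu).
    have := congr1 (fun u : {poly K} => u.[nu]) (subspace_poly_additive pK Vsub Vfin (- nu)).
    by rewrite /= horner_comp !hornerD !hornerX !hornerC => ->.
  (* As q is constant, any nontrivial root of unity of order dividing p^e - 1 would give a scaling
     in the eigengroup. *)
  have pe1 : (p ^ e - 1 = 1)%N.
    apply/eqP; rewrite eqn_leq pe_gt0 andbT leqNgt; apply/negP => pe1.
    have [l [l1 _ lE]] := unity_root_pred pe1 (dvdnn _).
    case/eqP: l1; apply: (statement1_scale S1 lE hd) => -[|j]; first by rewrite expr0.
    by rewrite nth_default ?sq // eqxx.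
  have p2 : (p ^ e = 2)%N by rewrite -(subnK (_ : 0 < p ^ e)%N) ?pe1 // expn_gt0 prime_gt0.
  have p_gt1 := prime_gt1 p_pr; case: e e_gt0 p2 => // -[|k] _.
    by rewrite expn1 => ->.
  move=> p2; suff : (2 < p ^ k.+2)%N by rewrite p2.
  apply: (@leq_trans (2 ^ k.+2)%N); last by rewrite leq_exp2r.
  by apply: (@leq_trans (2 ^ 2)%N) => //; rewrite leq_exp2l.
right; split=> // nu _.
have [[i q] iqU] := nu_decomp_exists pK Vsub Vfin nu hm hg.
exists (i, q); split=> //=; have [/= hd _] := iqU.
(* If d > 1, a nontrivial d-th root of unity is killed by all exponents of q and contradicts
   statement 1. *)
set d := gcdn _ _.
have d_gt0 : (0 < d)%N by rewrite gcdn_gt0 pe_gt0.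
apply/eqP; rewrite eqn_leq d_gt0 andbT leqNgt; apply/negP => d1.
have [l [l1 ld lE]] := unity_root_pred d1 (dvdn_gcdl _ _).
case/eqP: l1; apply: (statement1_scale S1 lE hd) => j qj.
have /dvdn_expgcd/(_ j qj)/dvdnP[k ->] : (d %| expgcd q)%N.
  exact: dvdn_trans (dvdn_gcdr _ _) (dvdn_part _ _).
by rewrite mulnC exprM ld expr1n.
Qed.

Lemma statement1_2 : statement1 V h -> statement2 p e V h.
Proof.
move=> S1; have /statement1E[GV _] := S1.
have [g hg] : exists g, h = g \Po F.
  by apply: subspace_poly_comp pK Vsub Vfin _ _ => v /GV.
have sF := subspace_poly_size pK Vsub Vfin.
have gm : g \is monic.
  move: hm; rewrite hg !monicE lead_coef_comp //.
  by rewrite (monicP (subspace_poly_monic pK Vsub Vfin)) expr1n mulr1.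
exists g; split; first split=> // g' [_]; first by rewrite hg => /comp_poly_inj; exact.
by split; [exact: statement1_cond_a|exact: statement1_cond_b].
Qed.

Lemma comp_cond_b_translate g w : h = g \Po F -> cond_b V h ->
  V w <-> h \Po ('X + w%:P) = h.
Proof.
move=> hg hb; have [V0 _ _] := Vsub; split=> [Vw|hw].
  by rewrite hg -comp_polyA (subspace_poly_translate pK Vsub Vfin Vw).
have /closed_rootP[y hy] : size h != 1%N by rewrite gtn_eqF.
(* The roots y + w and y of h differ by w, so (b) applies to this pair if w is not in V. *)
apply: contrapT => nV; have ywy : y + w - y = w by rewrite addrC addKr.
apply: (hb (y + w) y); rewrite ?ywy //.
- by move: hy; rewrite !rootE -{1}hw horner_comp hornerD hornerX hornerC.
- by apply: contra_not_neq nV => E; rewrite -ywy E subrr.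
- exact/(roots_stable_line _ hm).
Qed.

(* A scaling of h normalises the group of translations of h, hence its ratio
   lies in the multiplier field. *)
Lemma eigen_ratio_multiplier (l m : K) :
  (forall w, V w <-> h \Po ('X + w%:P) = h) -> eigengroup h (sigma l m) ->
  l != 0 /\ l ^+ (p ^ e) = l.
Proof.
move=> GV /(eigengroup_sigma _ _ hm)[l0 [c hc]]; split=> //.
(* Conjugation by the substitution turns translation by v into translation by v / l, so it is the
   inverse of l that is shown to multiply V into itself. *)
apply: invr_inj; rewrite -exprVn.
apply: (mem_multiplier pK Vsub Vfin Ve Vn0) => v /GV hv; apply/GV.
have c0 : c != 0.
  apply/eqP => c0; have : sigma l m h == 0 by rewrite hc c0 scale0r.
  have sX : size (l *: 'X + m%:P) = 2%N.
    by rewrite size_polyDl size_scale ?size_polyX // size_polyC; case: eqP.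
  by rewrite /sigma comp_poly2_eq0 // (negbTE (monic_neq0 hm)).
apply: (scalerI c0); rewrite -comp_polyZ -hc /sigma -comp_polyA.
rewrite comp_polyD comp_polyZ comp_polyX comp_polyC scalerDr -mul_polyC -mul_polyC.
rewrite -polyCM mulVKf // mul_polyC addrAC.
by rewrite -[in RHS]hv -comp_polyA comp_polyD comp_polyX comp_polyC.
Qed.

(* If h does not vanish at the fixed point nu then the eigenvalue is 1, and
   differentiating the eigenvalue equation at nu gives l h'(nu) = h'(nu). *)
Lemma eigen_fixpoint_critical (l nu : K) : l != 1 ->
  eigengroup h (sigma l ((1 - l) * nu)) -> (Rd h `|` Rd h^`()) nu.
Proof.
move=> l1 /(eigengroup_sigma _ _ hm)[_ [c hc]].
have fixnu : (l *: 'X + ((1 - l) * nu)%:P).[nu] = nu.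
  by rewrite hornerD hornerZ hornerX hornerC -mulrDl addrC subrK mul1r.
have [hnu|hnu] := eqVneq h.[nu] 0; [by left; apply/eqP|right].
have c1 : c = 1.
  apply: (mulIf hnu); rewrite mul1r -hornerZ -hc /sigma horner_comp.
  by rewrite fixnu.
have := congr1 (fun u : {poly K} => u^`().[nu]) hc.
rewrite /sigma c1 scale1r deriv_comp derivD derivZ derivX derivC addr0.
rewrite hornerM horner_comp fixnu hornerZ hornerC mulr1 -[RHS]mulr1 => /eqP.
by rewrite -subr_eq0 -mulrBr mulf_eq0 subr_eq0 (negbTE l1) orbF.
Qed.

Lemma cond_a_eigen g (l nu : K) : h = g \Po F -> cond_a p e V h g ->
  l != 0 -> l ^+ (p ^ e) = l -> eigengroup h (sigma l ((1 - l) * nu)) -> l = 1.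
Proof.
move=> hg ha l0 lE Eh; apply/eqP; apply: contraT => l1.
case: ha => [[_ [p2 e1]]|[g2 ha]].
  move: lE; rewrite p2 e1 expr2 -[RHS]mulr1 => /(mulfI l0)/eqP.
  by rewrite (negbTE l1).
have [[i q] [[/= hd _] gcd1]] := ha _ (eigen_fixpoint_critical l1 Eh).
have lq := (eigen_nu_decomp pK Vsub Vfin Ve hm l0 lE hd).1 Eh.
have lE1 : l ^+ (p ^ e - 1) = 1.
  apply: (mulIf l0); rewrite -exprSr mul1r -addn1 subnK //.
  by rewrite expn_gt0 prime_gt0.
have [n ln npe] := prim_order_exists pe_gt0 lE1.
have nq : (n %| expgcd q)%N.
  by apply/dvdn_expgcd => j /lq lj; rewrite (prim_order_dvd ln) lj.
have [qm q0 hq] := hd.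
(* If q were constant, h would be P^i and g a power of X + b, with at most one root. A nonconstant q
   has a positive gcd of exponents, as its prime-to-p part requires below. *)
have sq : (1 < size q)%N.
  rewrite ltnNge; apply/negP => /size1_polyC qC; move: qm hq.
  rewrite qC monicE lead_coefC => /eqP ->; rewrite comp_polyC mulr1 hg.
  rewrite (shifted_subspace_polyE pK Vsub Vfin); set b := _.[- nu].
  rewrite (_ : (_ + b%:P) ^+ i = ('X + b%:P) ^+ i \Po F); last first.
    by rewrite rmorphXn /= comp_polyD comp_polyX comp_polyC.
  move/(comp_poly_inj (subspace_poly_size pK Vsub Vfin)) => gE.
  move: g2; rewrite ltnNge (_ : nRd g <= 1)%N //; apply: (@nRd_le1 _ _ (- b)).
  move=> z; rewrite /Rd /= gE rootE horner_exp hornerD hornerX hornerC.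
  by rewrite expf_eq0 addr_eq0 => /andP[_ /eqP].
(* The order n of l divides p^e - 1, so it is prime to p and survives in the prime-to-p part of the
   exponent gcd. *)
have : (n %| 1)%N.
  rewrite -gcd1 dvdn_gcd npe /=; have := partn_dvd p^' (expgcd_gt0 sq) nq.
  by rewrite part_pnat_id // p'natE // (dvdn_pred_expn_primeN p_pr e_gt0 npe).
rewrite dvdn1 => /eqP n1; move: (prim_expr_order ln).
by rewrite n1 expr1 => /eqP; rewrite (negbTE l1).
Qed.

Lemma statement2_1 : statement2 p e V h -> statement1 V h.
Proof.
case=> g [[[gm hg] _] [ha hb]].
have GV w := comp_cond_b_translate w hg hb.
apply/statement1E; split=> // l m Eh.
have [l0 lE] := eigen_ratio_multiplier GV Eh.
have [//|l1] := eqVneq l 1.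
by rewrite (sigma_fixpoint m l1) in Eh; exact: cond_a_eigen hg ha l0 lE Eh.
Qed.

End Equivalence.

(** * Invariants, and the passage from f1 to f *)

Lemma invariants_Sh (K : fieldType) (V : set K) (h : {poly K}) : h \is monic ->
  statement1 V h -> invariants (eigengroup h) h.
Proof.
move=> hm [GV _ /Gbar_trivialP ->] t; rewrite GV => -[v Vv <-].
by rewrite sigma1; exact: ((Gtilde_Sh V hm).1 GV v).1.
Qed.

Theorem theorem4p22 (K : closedFieldType) (p : nat) (charKp : p \in [pchar K])
    (f : {poly K}) (f_monic : f \is monic) (f_nonscalar : (1 < size f)%N)
    (f_roots : (2 <= nRd f)%N)
    (s : nat) (f_gcd : expgcd f = (p ^ s * expgcd_p p f)%N) :
  exists f1 : {poly K},
    unique (fun h : {poly K} =>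
      [/\ h \is monic, (1 < size h)%N & f = h ^+ (p ^ s)]) f1 /\
    forall (V : set K) (e : nat),
      Fp_subspace V -> Fp_fin_dim V -> V <> [set 0] -> is_multiplier p V e ->
      [/\ statement1 V f <-> statement2 p e V f1,
          cond_b V f1 <-> cond_b V f &
          statement1 V f ->
            [/\ invariants (eigengroup f) f, invariants (eigengroup f) f1 &
                invariants (eigengroup f) = invariants (eigengroup f1)]].
Proof.
have [f1 ff1] : exists f1, f = f1 ^+ (p ^ s).
  by apply: poly_Frobenius_root => //; rewrite f_gcd dvdn_mulr.
have pX : p \in [pchar {poly K}] by rewrite pchar_poly.
(* In characteristic p the only p^s-th root of 1 is 1. *)
have f1m : f1 \is monic.
  rewrite monicE; apply/eqP; apply: (Frobenius_inj (s := s) charKp) => /=.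
  by rewrite -lead_coef_exp -ff1 (monicP f_monic) expr1n.
have sf1 : (1 < size f1)%N.
  rewrite ltnNge; apply/negP => /size1_polyC f1C; move: f_nonscalar.
  by rewrite ff1 f1C -rmorphXn /= ltnNge size_polyC_leq1.
have ps_gt0 : (0 < p ^ s)%N by rewrite expn_gt0 prime_gt0 // (pcharf_prime charKp).
have EE : eigengroup f = eigengroup f1 by rewrite ff1 eigengroup_exp_pchar.
have S1 V : statement1 V f <-> statement1 V f1.
  by split; apply: statement1_eigengroup.
exists f1; split.
  by split=> // h [_ _]; rewrite ff1; exact: (Frobenius_inj pX).
move=> V e Vsub Vfin Vn0 Ve; split.
- rewrite S1; split; first exact: statement1_2.
  exact: statement2_1.
- by rewrite ff1 cond_b_exp // monic_neq0.
- move=> Sf; split; [exact: invariants_Sh Sf| |by rewrite EE].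
  by rewrite EE; apply: (invariants_Sh f1m); apply/S1; exact: Sf.
Qed.
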